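(* Let $(\mathcal{A},\mathcal{B},\mathfrak{F},d,\tau)$ be a fusion bialgebra. Suppose that the dual has the Schur product property, i.e. $u*_{\mathcal{B}}v\ge0$ for all $u,v\ge0$ in $\mathcal{B}$. Then for any nonzero $x,y\in\mathcal{B}$, $$\mathcal{S}(\mathcal{R}(x)*_{\mathcal{B}}\mathcal{R}(y))\ge\max\{\mathcal{S}(x),\mathcal{S}(y)\}.$$
   Context: Fusion bialgebra: let $\mathcal{A}$ and $\mathcal{B}$ be finite-dimensional $C^*$-algebras with faithful (positive, not necessarily normalized) traces $d$ and $\tau$ respectively, with $\mathcal{A}$ commutative. The multiplication and involution of $\mathcal{A}$ are written $\diamond$ and $\#$, those of $\mathcal{B}$ are written $xy$ and $*$. Let $\mathfrak{F}:\mathcal{A}\to\mathcal{B}$ be a linear bijection with $\tau(\mathfrak{F}(x)^*\mathfrak{F}(y))=d(x^\#\diamond y)$ for all $x,y\in\mathcal{A}$. The quintuple $(\mathcal{A},\mathcal{B},\mathfrak{F},d,\tau)$ is a fusion bialgebra if: (1) for $x,y\ge0$ in $\mathcal{A}$, $x*y:=\mathfrak{F}^{-1}(\mathfrak{F}(x)\mathfrak{F}(y))\ge0$ in $\mathcal{A}$; (2) $J(x):=\mathfrak{F}^{-1}(\mathfrak{F}(x)^* )$ is an anti-linear $*$-isomorphism of $\mathcal{A}$; (3) $\mathfrak{F}^{-1}(1_{\mathcal{B}})$ is a positive multiple of a minimal projection of $\mathcal{A}$. Convolution on $\mathcal{B}$: $x*_{\mathcal{B}}y:=\big(\mathfrak{F}(\mathfrak{F}^{-1}(y^*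 )\diamond\mathfrak{F}^{-1}(x^* ))\big)^*$. For $x\in\mathcal{B}$, $\mathcal{R}(x)$ is its range projection in $\mathcal{B}$ and $\mathcal{S}(x)=\tau(\mathcal{R}(x))$. *)

(* Defs.v *)
From HB Require Import structures.
From mathcomp Require Import all_boot all_order all_algebra all_field.
From mathcomp Require Import complex.
From mathcomp Require Import boolp classical_sets reals.

Set Implicit Arguments.
Unset Strict Implicit.
Unset Printing Implicit Defensive.

Import Order.TTheory GRing.Theory Num.Theory.
Local Open Scope ring_scope.
Local Open Scope complex_scope.

(* Finite-dimensional C*-algebras over the complex numbers R[i].  Completeness
   is not required as an axiom: it is automatic in finite dimension.  As every
   finite-dimensional C*-algebra is unital, the unit is part of the carrier. *)
HB.mixin Record Falgebra_isCStar (R : realType) A of Falgebra R[i] A := {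
  star : A -> A ;
  starK : involutive star ;
  starD : forall x y : A, star (x + y) = star x + star y ;
  starZ : forall (a : R[i]) (x : A), star (a *: x) = Num.conj a *: star x ;
  starM : forall x y : A, star (x * y) = star y * star x ;
  cnorm : A -> R ;
  cnorm0_eq0 : forall x : A, cnorm x = 0 -> x = 0 ;
  cnormD : forall x y : A, cnorm (x + y) <= cnorm x + cnorm y ;
  (* `|a| is an element of R[i], hence the real part. *)
  cnormZ : forall (a : R[i]) (x : A),
    cnorm (a *: x) = complex.Re `|a| * cnorm x ;
  cnormM : forall x y : A, cnorm (x * y) <= cnorm x * cnorm y ;
  cnorm_star : forall x : A, cnorm (star x * x) = cnorm x ^+ 2
}.

#[short(type="cstarType")]
HB.structure Definition CStar (R : realType) :=
  { A of Falgebra_isCStar R A & Falgebra R[i] A }.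

Section CStarTheory.
Variables (R : realType) (A : cstarType R).
Implicit Types x y p q : A.

Definition cpositive x : Prop := exists y, x = star y * y.

Definition projection p : Prop := star p = p /\ p * p = p.

(* For projections, q <= p means p * q = q. *)
Definition minimal_projection p : Prop :=
  [/\ projection p, p <> 0
    & forall q, projection q -> p * q = q -> q = 0 \/ q = p].

(* p is the least projection such that p * x = x. *)
Definition is_range_projection x p : Prop :=
  [/\ projection p, p * x = x
    & forall q, projection q -> q * x = x -> q * p = p].

Definition range_projection x : A :=
  xget 0 [set p | is_range_projection x p]%classic.

Record faithful_trace (t : {scalar A}) : Prop := FaithfulTrace {
  trace_mulC : forall x y, t (x * y) = t (y * x) ;
  trace_ge0 : forall x, cpositive x -> 0 <= t x ;
  trace_faithful : forall x, cpositive x -> t x = 0 -> x = 0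
}.

(* On the projection range_projection x the trace is a nonnegative real. *)
Definition support_size (t : {scalar A}) x : R[i] := t (range_projection x).

End CStarTheory.

Section FusionBialgebra.
Variables (R : realType) (A B : cstarType R).
Variables (F : 'Hom(A, B)) (d : {scalar A}) (tau : {scalar B}).

(* (F^-1)%VF is the two-sided inverse of F as soon as F is bijective. *)
Definition convolution (x y : A) : A := (F^-1)%VF (F x * F y).

Definition fusion_J (x : A) : A := (F^-1)%VF (star (F x)).

Definition dual_convolution (x y : B) : B :=
  star (F ((F^-1)%VF (star y) * (F^-1)%VF (star x))).

Record antilinear_star_isomorphism (J : A -> A) : Prop :=
  AntilinearStarIsomorphism {
    antiisoD : forall x y, J (x + y) = J x + J y ;
    antiisoZ : forall (a : R[i]) x, J (a *: x) = Num.conj a *: J x ;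
    antiisoM : forall x y, J (x * y) = J x * J y ;
    antiiso_star : forall x, J (star x) = star (J x) ;
    antiiso_bij : bijective J
  }.

Record fusion_bialgebra : Prop := FusionBialgebra {
  fusion_mulC : forall x y : A, x * y = y * x ;
  fusion_d_trace : faithful_trace d ;
  fusion_tau_trace : faithful_trace tau ;
  fusion_F_bij : bijective F ;
  fusion_plancherel : forall x y : A, tau (star (F x) * F y) = d (star x * y) ;
  fusion_schur : forall x y : A,
    cpositive x -> cpositive y -> cpositive (convolution x y) ;
  fusion_J_iso : antilinear_star_isomorphism fusion_J ;
  fusion_unit : exists (c : R[i]) (p : A),
    [/\ 0 < c, minimal_projection p & (F^-1)%VF 1 = c *: p]
}.

Definition dual_schur_property : Prop :=
  forall u v : B, cpositive u -> cpositive v -> cpositive (dual_convolution u v).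

End FusionBialgebra.

(* Main.v *)
(* Since F^-1(1) is a multiple of a minimal projection, a |-> k tau (F a) is a
   character of A for some k > 0.  By the dual Schur property the cone of all b
   with F b >= 0 is closed under products, so it contains the powers of its
   elements, and on it the 2-norm of F b is at most a multiple of tau (F b).
   Normalizing k tau (F b) = 1, the powers of b stay bounded, which forces
   |b| <= 1 pointwise, hence the Young inequality
     |F (a b)|_2 <= k tau (F b) |F a|_2.
   If F a and F b are the two range projections, w = F (a b) has
   tau w = k tau (F a) tau (F b), and Cauchy-Schwarz for w = R(w) w gives
     (tau w)^2 <= S(w) |w|_2^2 <= S(w) (k tau (F b))^2 tau (F a),
   that is, tau (F a) <= S(w); exchanging a and b gives the other bound. *)
Require Import Defs.
From HB Require Import structures.
From mathcomp Require Import all_boot all_order all_algebra all_field.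
From mathcomp Require Import complex.
From mathcomp Require Import boolp classical_sets reals.
From mathcomp Require Import ring.

Set Implicit Arguments.
Unset Strict Implicit.
Unset Printing Implicit Defensive.

Import Order.TTheory GRing.Theory Num.Theory.
Local Open Scope ring_scope.
Local Open Scope complex_scope.

(** * Bounded powers and doubling inequalities for scalars *)

Section BoundedPowers.

Lemma ler_Bernoulli (F : realFieldType) (e : F) n :
  0 <= e -> 1 + e *+ n <= (1 + e) ^+ n.
Proof.
move=> e0; elim: n => [|n IH]; first by rewrite mulr0n addr0 expr0.
rewrite exprS mulrDl mul1r mulrS addrCA addrC lerD //.
by rewrite ler_peMr // exprn_ege1 // lerDl.
Qed.

(** If [x > 1], pick [n] with [K < n * (x - 1)]; since [n < 2 ^ n], Bernoulli pushes [x ^+ (2 ^ n)]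
    above [K]. *)
Lemma ler1_bounded_expr2n (F : archiRealFieldType) (x K : F) :
  0 <= x -> (forall m, x ^+ (2 ^ m) <= K) -> x <= 1.
Proof.
move=> x0 xK; rewrite leNgt; apply/negP => x1.
have e0 : 0 < x - 1 by rewrite subr_gt0.
have K0 : 0 <= K by apply: le_trans (xK 0); rewrite exprn_ge0.
have := archi_boundP (divr_ge0 K0 (ltW e0)).
set n := Num.bound _; rewrite ltr_pdivrMr // => Kn.
suff : K < K by rewrite ltxx.
apply: lt_le_trans (xK n); apply: lt_trans Kn _.
have {2}-> : x = 1 + (x - 1) by rewrite addrC subrK.
apply: lt_le_trans (ler_Bernoulli _ (ltW e0)).
rewrite -(mulr_natl (x - 1)) -[ltLHS]add0r ltr_leD // ler_pM2r // ler_nat.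
exact: ltnW (ltn_expl _ _).
Qed.

Lemma lec1_bounded_expr2n (R : realType) (x K : R[i]) :
  0 <= x -> (forall m, x ^+ (2 ^ m) <= K) -> x <= 1.
Proof.
move=> x0 xK.
have K0 : 0 <= K by apply: le_trans (xK 0); rewrite exprn_ge0.
have realE (z : R[i]) : 0 <= z -> z = (complex.Re z)%:C.
  by case: z => a b; rewrite lecE /= => /andP[/eqP->].
have xE := realE _ x0; have KE := realE _ K0; move: xE KE x0 xK {K0}.
move: (complex.Re x) (complex.Re K) => r k -> -> r0 rk.
rewrite -(rmorph1 (real_complex R)).
rewrite lecR; apply: (@ler1_bounded_expr2n _ _ k).
  by rewrite -lecR.
by move=> m; have := rk m; rewrite -rmorphXn lecR.
Qed.

(** The ratios [q n = f n / (f 0 * g ^+ n)] satisfy [q n ^+ 2 <= q n.*2], so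
    [q 1 ^+ (2 ^ m) <= q (2 ^ m) <= K / f 0] for all [m], which forces [q 1 <= 1]. *)
Lemma le_sqr_doubling (R : realType) (f : nat -> R[i]) (K g : R[i]) :
  (forall n, 0 <= f n) -> 0 < f 0 -> 0 < g ->
  (forall n, f n ^+ 2 <= f 0 * f n.*2) -> (forall n, f n <= K * g ^+ n) ->
  f 1 <= f 0 * g.
Proof.
move=> f_ge0 f0 g0 f2 fK.
suff : f 1 / (f 0 * g) <= 1 by rewrite ler_pdivrMr ?mulr_gt0 // mul1r.
apply: (@lec1_bounded_expr2n _ _ (K / f 0)) => [|m].
  by rewrite divr_ge0 // mulr_ge0 // ltW.
have h (n : nat) : 0 < f 0 * g ^+ n by rewrite mulr_gt0 // exprn_gt0.
apply: (@le_trans _ _ (f (2 ^ m)%N / (f 0 * g ^+ (2 ^ m)))).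
  elim: m => [|m IH]; first by rewrite !expn0 !expr1.
  rewrite expnSr exprM.
  apply: (@le_trans _ _ ((f (2 ^ m)%N / (f 0 * g ^+ (2 ^ m))) ^+ 2)).
    by rewrite lerXn2r // nnegrE ?exprn_ge0 ?divr_ge0 // ltW // mulr_gt0.
  have -> : g ^+ (2 ^ m * 2) = (g ^+ (2 ^ m)) ^+ 2 by rewrite exprM.
  rewrite muln2; move: (h (2 ^ m)%N) (f2 (2 ^ m)%N).
  move: (f (2 ^ m)%N) (f (2 ^ m).*2) (g ^+ _) => u v G f0G le_uv.
  have -> : v / (f 0 * G ^+ 2) = f 0 * v / (f 0 * G) ^+ 2.
    have := gt_eqF f0G; rewrite mulf_eq0 => /norP[nz0 nzG].
    by field; rewrite nz0 nzG.
  by rewrite exprMn exprVn ler_pM2r // invr_gt0 exprn_gt0.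
rewrite ler_pdivrMr // mulrA divfK ?gt_eqF //.
Qed.

End BoundedPowers.

(** * The 2-norm of a faithful trace *)

Section TracialCStar.
Variables (R : realType) (A : cstarType R) (t : {scalar A}).
Hypothesis ht : faithful_trace t.
Implicit Types x y z p q : A.

Lemma star0 : star (0 : A) = 0.
Proof. by apply: (addrI (star 0)); rewrite -starD !addr0. Qed.

Lemma starN x : star (- x) = - star x.
Proof. by apply: (addrI (star x)); rewrite -starD !subrr star0. Qed.

Lemma starB x y : star (x - y) = star x - star y.
Proof. by rewrite starD starN. Qed.

Lemma star1 : star (1 : A) = 1.
Proof. by rewrite -[LHS]mul1r -{1}(starK 1) -starM mul1r starK. Qed.

Lemma cpositive_star x : cpositive x -> star x = x.
Proof. by case=> y ->; rewrite starM starK. Qed.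

Lemma cpositive_projection p : projection p -> cpositive p.
Proof. by case=> ps pp; exists p; rewrite ps pp. Qed.

Lemma trace_star_mul_ge0 x : 0 <= t (star x * x).
Proof. by apply: (trace_ge0 ht); exists x. Qed.

Lemma trace_star_mul_eq0 x : t (star x * x) = 0 -> x = 0.
Proof.
move=> tx; have h : star x * x = 0 by apply: (trace_faithful ht) tx; exists x.
by apply: cnorm0_eq0; apply/eqP; rewrite -sqrf_eq0 -cnorm_star h;
  rewrite -(scale0r (0 : A)) cnormZ normr0 mul0r.
Qed.

(** By polarization [t (star u * v) + t (star v * u)] is real; [u = 1] with [v = x] and
    [v = 'i *: x] gives two equations that determine [t (star x)]. *)
Lemma trace_star x : t (star x) = Num.conj (t x).
Proof.
have tr z : t (star z * z) \is Num.real.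
  by rewrite ger0_real ?trace_star_mul_ge0.
have t2 u v : t (star u * v) + t (star v * u) \is Num.real.
  have -> : t (star u * v) + t (star v * u) =
      t (star (u + v) * (u + v)) - t (star u * u) - t (star v * v).
    by rewrite starD mulrDl !mulrDr !linearD /=; ring.
  by rewrite !realB // tr.
have := t2 1 x; have := t2 1 ('i *: x).
rewrite starZ -scalerAr -scalerAl !scalarZ /= conjCi star1 !mul1r !mulr1.
move=> /CrealP; rewrite rmorphD !rmorphM /= rmorphN /= conjCi => e1.
move=> /CrealP; rewrite rmorphD /= => e2.
have : 2 * Num.conj (t (star x)) = 2 * t x.
  apply: (mulfI (neq0Ci R[i])); move: e1 e2.
  move: (t x) (t (star x)) => a b e1 e2.
  have -> : 'i * (2 * Num.conj b) = (- 'i * Num.conj a + - - 'i * Num.conj b)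
    + 'i * (Num.conj a + Num.conj b) by ring.
  by rewrite e1 e2; ring.
have nz2 : 2 != 0 :> R[i] by rewrite pnatr_eq0.
by move/(mulfI nz2) => <-; rewrite conjCK.
Qed.

Lemma trace_star_mulC x y : t (star y * x) = Num.conj (t (star x * y)).
Proof. by rewrite -trace_star starM starK. Qed.

Lemma trace_Cauchy_Schwarz x y :
  `|t (star x * y)| ^+ 2 <= t (star x * x) * t (star y * y).
Proof.
have [/trace_star_mul_eq0 -> | Nx] := eqVneq (t (star x * x)) 0.
  by rewrite star0 !mul0r !linear0 normr0 expr0n mul0r.
(* This vector is the component of [y] orthogonal to [x], scaled by [t (star x * x)] to avoid a
   division. *)
have := trace_star_mul_ge0 (t (star x * x) *: y - t (star x * y) *: x).
rewrite starB !starZ mulrBl !mulrBr -!scalerAl -!scalerAr !linearB /= !scalarZ.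
rewrite (geC0_conj (trace_star_mul_ge0 x)) /= (trace_star_mulC x y) normCK.
have Nx0 : 0 < t (star x * x) by rewrite lt0r Nx trace_star_mul_ge0.
move: (t (star x * y)) (t (star x * x)) (t (star y * y)) Nx0 => c u v u0 h.
rewrite -subr_ge0 -(pmulr_rge0 _ u0); apply: le_trans h _.
by rewrite le_eqVlt; apply/orP; left; apply/eqP; ring.
Qed.

Lemma trace_parallelogram_le x y :
  t (star (x + y) * (x + y)) <= 2 * (t (star x * x) + t (star y * y)).
Proof.
rewrite -subr_ge0; apply: le_trans (trace_star_mul_ge0 (x - y)) _.
rewrite starB starD mulrBl (mulrDl (star x)) !mulrBr !mulrDr.
rewrite !linearB !linearD /=.
by rewrite le_eqVlt; apply/orP; left; apply/eqP; ring.
Qed.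

Lemma bounded_bilinear_sum (I : Type) (r : seq I) (f : I -> A -> A -> A) :
  (forall i, exists C, forall x y, t (star (f i x y) * f i x y) <=
     C * (t (star x * x) * t (star y * y))) ->
  exists C, forall x y,
    t (star (\sum_(i <- r) f i x y) * \sum_(i <- r) f i x y) <=
    C * (t (star x * x) * t (star y * y)).
Proof.
move=> bf; elim: r => [|i r [C hC]].
  by exists 0 => x y; rewrite big_nil mulr0 linear0 mul0r.
have [D hD] := bf i; exists (2 * (D + C)) => x y.
rewrite big_cons; apply: le_trans (trace_parallelogram_le _ _) _.
by rewrite -mulrA ler_pM2l // mulrDl lerD.
Qed.

Let n : nat := \dim {:A}.
Let e i : A := (vbasis {:A})`_i.

Definition trace_row x : 'rV[R[i]]_n := \row_i t (x * e i).

Fact trace_row_linear : linear trace_row.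
Proof.
by move=> a x y; apply/rowP => i; rewrite !mxE mulrDl -scalerAl linearP.
Qed.

HB.instance Definition _ :=
  GRing.isLinear.Build R[i] A 'rV[R[i]]_n _ trace_row trace_row_linear.

(** Riesz representation: if [t (x * _)] vanishes on the basis, it vanishes at [star x], so [x = 0]
    by faithfulness; an injective map between spaces of equal dimension is onto. *)
Lemma trace_row_onto v : exists x, trace_row x = v.
Proof.
pose f := linfun trace_row.
have kf : lker f = 0%VS.
  apply/eqP; rewrite -subv0; apply/subvP => x; rewrite memv_ker memv0 lfunE /=.
  move=> /eqP/rowP x0; rewrite -[x]starK; apply/eqP.
  suff -> : star x = 0 by rewrite star0.
  apply: trace_star_mul_eq0; rewrite starK.
  rewrite (coord_vbasis (memvf (star x))) mulr_sumr linear_sum big1 //= => i _.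
  by have := x0 i; rewrite !mxE -scalerAr scalarZ /= => ->; rewrite mulr0.
have vf : v \in limg f.
  suff -> : limg f = fullv by rewrite memvf.
  apply/eqP; rewrite -dimv_leqif_eq ?subvf //.
  have := limg_ker_dim f fullv; rewrite kf capv0 dimv0 add0n => ->.
  by apply/eqP; rewrite [RHS]dimvf dim_matrix mul1r.
by have [x _ ->] := memv_imgP vf; exists x; rewrite lfunE.
Qed.

Lemma trace_dual_basis :
  exists g : 'I_n -> A, forall x, x = \sum_j t (g j * x) *: e j.
Proof.
have [g hg] := fin_all_exists (fun j => trace_row_onto (delta_mx 0 j)).
exists g => x; rewrite {1}(coord_vbasis (memvf x)); apply: eq_bigr => j _.
congr (_ *: _); rewrite {2}(coord_vbasis (memvf x)) mulr_sumr linear_sum.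
rewrite (bigD1 j) //= big1 ?addr0 => [|i ij]; rewrite -scalerAr scalarZ /=.
  by have /rowP/(_ j) := hg j; rewrite !mxE !eqxx => ->; rewrite mulr1.
have /rowP/(_ i) := hg j.
by rewrite !mxE (negbTE ij) andbF => ->; rewrite mulr0.
Qed.

(** The dual basis turns the product into a finite sum of terms [t (g i * x) * t (g j * y)] times
    fixed elements, each bounded by Cauchy-Schwarz. *)
Lemma trace_norm_mul_bounded : exists C, forall x y,
  t (star (x * y) * (x * y)) <= C * (t (star x * x) * t (star y * y)).
Proof.
have [g hg] := trace_dual_basis.
pose f (ij : 'I_n * 'I_n) x y :=
  (t (g ij.1 * x) * t (g ij.2 * y)) *: (e ij.1 * e ij.2).
have [ij|C hC] := @bounded_bilinear_sum _ (index_enum _) f.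
  pose N x := t (star x * x).
  exists (N (star (g ij.1)) * N (star (g ij.2)) * N (e ij.1 * e ij.2)) => x y.
  rewrite /f starZ -scalerAl -scalerAr !scalarZ mulrA (mulrC _^*) -normCK.
  rewrite [leRHS]mulrAC ler_wpM2r ?trace_star_mul_ge0 //.
  rewrite normrM exprMn [leRHS]mulrACA /N.
  by rewrite ler_pM ?exprn_ge0 // -{1}(starK (g _)) trace_Cauchy_Schwarz.
exists C => x y; suff -> : x * y = \sum_ij f ij x y by exact: hC.
rewrite {1}(hg x) {1}(hg y) mulr_suml.
under eq_bigr do rewrite mulr_sumr.
rewrite pair_big /=; apply: eq_bigr => ij _.
by rewrite -scalerAl -scalerAr scalerA.
Qed.

Lemma trace_sqr_le_sqr_trace : exists C, forall u, cpositive u ->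
  t (star u * u) <= C * t u ^+ 2.
Proof.
have [C hC] := trace_norm_mul_bounded; exists C => _ [y ->].
apply: le_trans (hC _ _) _.
(* By traciality [y] and [star y] have the same 2-norm, with square [t u]. *)
by rewrite starK (trace_mulC ht y) expr2.
Qed.

End TracialCStar.

(** * Annihilating polynomials in finite dimension *)

Section AnnihilatingPolynomial.
Variables (K : fieldType) (A : falgType K) (x : A).

Definition horner_rV n (v : 'rV[K]_n) : A := horner_alg x (rVpoly v).

Fact horner_rV_linear n : linear (@horner_rV n).
Proof.
move=> a u v; rewrite /horner_rV [rVpoly _]linearP rmorphD /=.
rewrite -mul_polyC rmorphM /=.
by rewrite horner_algC -scalerAl mul1r.
Qed.

HB.instance Definition _ n :=
  GRing.isLinear.Build K 'rV[K]_n A _ (@horner_rV n) (@horner_rV_linear n).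

(** There are [n.+1] coefficients but [A] has dimension [n], so evaluation at [x] has a nonzero
    kernel. *)
Lemma annihilating_poly : exists2 P : {poly K}, P != 0 & horner_alg x P = 0.
Proof.
pose n : nat := \dim {:A}.
pose f : 'Hom('rV[K]_n.+1, A) := linfun (@horner_rV n.+1).
have fE v : f v = horner_rV v by exact: lfunE.
have kf : lker f != 0%VS.
  apply/eqP => kf; have := limg_ker_dim f fullv.
  rewrite kf capv0 dimv0 add0n => e.
  have : (\dim (limg f) <= n)%N by exact/dimvS/subvf.
  by rewrite e dimvf dim_matrix mul1r ltnn.
exists (rVpoly (vpick (lker f))).
  by rewrite -(raddf0 (@rVpoly K n.+1)) (can_eq (@rVpolyK _ _)) vpick0.
by have := memv_pick (lker f); rewrite memv_ker fE => /eqP.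
Qed.

End AnnihilatingPolynomial.

(** * Range projections and minimal projections *)

Section RangeProjection.
Variables (R : realType) (A : cstarType R) (t : {scalar A}).
Hypothesis ht : faithful_trace t.
Implicit Types x y z p q : A.

Lemma limg_amullP x y : reflect (exists c, y = x * c) (y \in limg (amull x)).
Proof.
apply: (iffP memv_imgP) => [[c _ ->]|[c ->]]; exists c;
  by rewrite ?memvf ?lfunE.
Qed.

Lemma lker_amullP x z : reflect (x * z = 0) (z \in lker (amull x)).
Proof. by rewrite memv_ker lfunE; apply: eqP. Qed.

Lemma limg_amullM_sub x y : (limg (amull (x * y)%R) <= limg (amull x))%VS.
Proof.
by apply/subvP => _ /limg_amullP[c ->]; apply/limg_amullP;
  exists (y * c); rewrite mulrA.
Qed.

Lemma dim_limg_star_mul x :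
  \dim (limg (amull (star x * x))) = \dim (limg (amull x)).
Proof.
have kE : lker (amull (star x * x)) = lker (amull x).
  apply/eqP; rewrite eqEsubv; apply/andP; split; apply/subvP => z.
    move/lker_amullP => h; apply/lker_amullP/(trace_star_mul_eq0 ht).
    by rewrite starM -mulrA [star x * _]mulrA h mulr0 linear0.
  by move/lker_amullP => h; apply/lker_amullP; rewrite -mulrA h mulr0.
have := limg_ker_dim (amull (star x * x)) fullv.
by rewrite kE -(limg_ker_dim (amull x) fullv) => /addnI.
Qed.

(* The left multiplications by x^* x and by x have the same kernel, so all of
   x^* x A, x A, x^* A have the same dimension; hence x^* x A = x^* A. *)
Lemma star_mul_solvable x : exists c, star x * x * c = star x.
Proof.
suff /eqP E : limg (amull (star x * x)) == limg (amull (star x)).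
  have : star x \in limg (amull (star x * x)).
    by rewrite E; apply/limg_amullP; exists 1; rewrite mulr1.
  by case/limg_amullP => c; exists c.
rewrite eqEdim limg_amullM_sub /= dim_limg_star_mul.
rewrite -(dim_limg_star_mul (star x)) starK.
exact/dimvS/limg_amullM_sub.
Qed.

Lemma range_projection_ex x : exists c, is_range_projection x (x * c).
Proof.
have [c hc] := star_mul_solvable x; exists c.
(* For [p = x * c] this reads [star p * p = star p]; its left side is self-adjoint, so [p] is a
   projection. *)
have pc : star (x * c) * (x * c) = star (x * c).
  by rewrite {1}starM -mulrA [star x * _]mulrA hc -starM.
have ps : star (x * c) = x * c.
  move: (x * c) pc => p pc.
  by have := congr1 star pc; rewrite starM starK pc.
split; first by split=> //; rewrite -{1}ps pc.
  by apply: (can_inj (@starK _ A)); rewrite starM ps mulrA hc.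
by move=> q _ qx; rewrite mulrA qx.
Qed.

Lemma range_projectionP x : is_range_projection x (range_projection x).
Proof.
rewrite /range_projection; case: xgetP => [y _ //|nox].
by have [c hc] := range_projection_ex x; case: (nox _ hc).
Qed.

Lemma support_Cauchy_Schwarz w : cpositive w ->
  t w ^+ 2 <= t (range_projection w) * t (star w * w).
Proof.
move=> w0; have [[rs rr] rw _] := range_projectionP w.
have := trace_Cauchy_Schwarz ht (range_projection w) w.
by rewrite rs rr rw ger0_norm // (trace_ge0 ht).
Qed.

(* In the corner p A every element is zero or invertible, because the range
   projection of p z lies below p; so p x is a root of some linear factor of an
   annihilating polynomial. *)
Lemma minimal_projection_scalar p x : (forall x y : A, x * y = y * x) ->
  minimal_projection p -> exists a, p * x = a *: p.
Proof.
move=> mulC [[ps pp] p0 pmin].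
have dichotomy z : p * z = 0 \/ exists c, p * z * c = p.
  have [c [rr rx _]] := range_projection_ex (p * z).
  case: (pmin _ rr) => [|r0|rp]; first by rewrite !mulrA pp.
    by left; rewrite -rx r0 mul0r.
  by right; exists c.
have [P P0 Px] := annihilating_poly x.
have [s Es] := closed_field_poly_normal P.
have : p * \prod_(a <- s) (x - a *: 1) = 0.
  have lP : lead_coef P != 0 by rewrite lead_coef_eq0.
  apply: (scalerI lP); rewrite scaler0 scalerAr.
  suff <- : horner_alg x P = lead_coef P *: \prod_(a <- s) (x - a *: 1).
    by rewrite Px mulr0.
  rewrite {1}Es -mul_polyC rmorphM /= horner_algC -scalerAl mul1r rmorph_prod.
  congr (_ *: _); apply: eq_bigr => a _.
  by rewrite rmorphB /= horner_algX horner_algC.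
elim: s {P P0 Px Es} => [|a s IH]; first by rewrite big_nil mulr1 => /p0.
rewrite big_cons; case: (dichotomy (x - a *: 1)) => [+ _|[c hc] h].
  by rewrite mulrBr -scalerAr mulr1 => /subr0_eq pxa; exists a.
(* Writing [p] as [p * (x - a *: 1) * c] brings back the full product, which vanishes; so the
   shorter product vanishes too. *)
apply: IH; rewrite -hc -mulrA [c * _]mulC mulrA -[p * _ * _]mulrA.
by rewrite h mul0r.
Qed.

End RangeProjection.

(** * The character, Young's inequality and the support bound *)

Section FusionBialgebraTheory.
Variables (R : realType) (A B : cstarType R) (F : 'Hom(A, B)).
Variables (d : {scalar A}) (tau : {scalar B}).
Hypothesis hfb : fusion_bialgebra F d tau.
Hypothesis hschur : dual_schur_property F.
Implicit Types a b : A.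

Let mulC := fusion_mulC hfb.
Let ht := fusion_tau_trace hfb.
Let hd := fusion_d_trace hfb.

Lemma fusion_FK : cancel F (F^-1)%VF.
Proof. exact/lker0_lfunK/lker0P/bij_inj/(fusion_F_bij hfb). Qed.

Lemma fusion_FVK : cancel (F^-1)%VF F.
Proof.
have [G _ GK] := fusion_F_bij hfb.
by move=> y; rewrite -(GK y) fusion_FK.
Qed.

(** As [F (c *: p) = 1], Plancherel gives [tau (F a) = c * s * d p], where [p * a = s *: p]. The
    scalar [s] is multiplicative in [a], whence [k = (c * d p)^-1]. *)
Lemma trace_fusion_mul : exists2 k, 0 < k &
  forall a b, tau (F (a * b)) = k * tau (F a) * tau (F b).
Proof.
have [c [p [c0 minp Fc]]] := fusion_unit hfb.
have [[ps pp] p0 _] := minp.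
have dp : 0 < d p.
  have := trace_star_mul_ge0 hd p; rewrite le0r => /orP[/eqP|].
    by move/(trace_star_mul_eq0 hd).
  by rewrite ps pp.
have tauE a s : p * a = s *: p -> tau (F a) = c * s * d p.
  move=> pa; have -> : F a = star (F (c *: p)) * F a.
    by rewrite -Fc fusion_FVK star1 mul1r.
  rewrite (fusion_plancherel hfb) starZ ps -scalerAl pa scalerA scalarZ.
  by rewrite geC0_conj // ltW.
exists (c * d p)^-1; first by rewrite invr_gt0 mulr_gt0.
move=> a b.
have [s ps_] := minimal_projection_scalar hd a mulC minp.
have [u pu] := minimal_projection_scalar hd b mulC minp.
rewrite (tauE _ _ ps_) (tauE _ _ pu) (tauE (a * b) (s * u)).
  by field; rewrite !gt_eqF.
by rewrite mulrA ps_ -scalerAl pu scalerA.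
Qed.

Lemma cpositive_fusion_mul a b :
  cpositive (F a) -> cpositive (F b) -> cpositive (F (a * b)).
Proof.
(* Dual convolution reverses its arguments, hence [pb] before [pa]. *)
move=> pa pb; have := hschur pb pa.
rewrite /dual_convolution (cpositive_star pa) (cpositive_star pb).
rewrite !fusion_FK => h.
by have := cpositive_star h; rewrite starK => ->.
Qed.

Lemma cpositive_fusion_mulX a b n :
  cpositive (F a) -> cpositive (F b) -> cpositive (F (a * b ^+ n)).
Proof.
move=> pa pb; elim: n => [|n IH]; first by rewrite mulr1.
by rewrite exprSr mulrA; apply: cpositive_fusion_mul.
Qed.

Lemma trace_cpositive_gt0 (u : B) : cpositive u -> u <> 0 -> 0 < tau u.
Proof.
move=> pu u0; rewrite lt0r (trace_ge0 ht pu) andbT; apply/eqP.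
by move/(trace_faithful ht pu).
Qed.

Lemma trace_fusion_mulX k :
  (forall a b, tau (F (a * b)) = k * tau (F a) * tau (F b)) ->
  forall a b n, tau (F (a * b ^+ n)) = tau (F a) * (k * tau (F b)) ^+ n.
Proof.
move=> hk a b; elim=> [|n IH]; first by rewrite !expr0 !mulr1.
by rewrite exprSr mulrA hk IH exprSr; ring.
Qed.

Lemma fusion_Young k a b : 0 < k ->
  (forall a b, tau (F (a * b)) = k * tau (F a) * tau (F b)) ->
  cpositive (F a) -> cpositive (F b) -> F a <> 0 -> F b <> 0 ->
  tau (star (F (a * b)) * F (a * b)) <=
    tau (star (F a) * F a) * (k * tau (F b)) ^+ 2.
Proof.
move=> k0 hk pa pb a0 b0.
have [C hC] := trace_sqr_le_sqr_trace ht.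
(* f is log-convex and grows at most like (k tau (F b)) ^+ (2 n). *)
pose f n := tau (star (F (a * b ^+ n)) * F (a * b ^+ n)).
have -> : tau (star (F (a * b)) * F (a * b)) = f 1 by [].
have f0 : f 0 = tau (star (F a) * F a) by rewrite /f expr0 mulr1.
rewrite -f0; apply: (@le_sqr_doubling _ _ (C * tau (F a) ^+ 2)).
- by move=> n; apply: trace_star_mul_ge0.
- rewrite f0 lt0r trace_star_mul_ge0 // andbT; apply/eqP.
  by move/(trace_star_mul_eq0 ht).
- by rewrite exprn_gt0 // mulr_gt0 // trace_cpositive_gt0.
(* Plancherel moves the norms to [A]. With [v = b ^+ n], commutativity makes [f n] the inner product
   of [a] with [star v * (v * a)], whose squared norm is [f n.*2]; Cauchy-Schwarz concludes. *)
- move=> n; rewrite /f expr0 mulr1 !(fusion_plancherel hfb) -addnn exprD.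
  move: (b ^+ n) => v.
  have mulCA x y z : x * (y * z) = y * (x * z) :> A.
    by rewrite mulrA (mulC x) -mulrA.
  have e1 : star (a * v) * (a * v) = star a * (star v * (v * a)).
    by rewrite starM -mulrA mulCA (mulC a v).
  have e2 : star (a * (v * v)) * (a * (v * v)) =
      star (star v * (v * a)) * (star v * (v * a)).
    rewrite !starM starK -!mulrA (mulC a) -!mulrA.
    rewrite (mulCA (star v) (star a)) (mulCA (star v) (star a)).
    by congr (_ * (_ * _)); rewrite mulCA.
  have := trace_Cauchy_Schwarz hd a (star v * (v * a)).
  by rewrite -e2 -e1 ger0_norm // trace_star_mul_ge0.
- move=> n; apply: le_trans (hC _ (cpositive_fusion_mulX n pa pb)) _.
  by rewrite (trace_fusion_mulX hk) exprMn -!exprM mulrA [(n * 2)%N]mulnC.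
Qed.

Lemma trace_le_support_fusion_mul a b :
  projection (F a) -> F a <> 0 -> cpositive (F b) -> F b <> 0 ->
  tau (F a) <= support_size tau (F (a * b)).
Proof.
move=> pra a0 pb b0; have pa := cpositive_projection pra.
have [k k0 hk] := trace_fusion_mul; have [as_ aa] := pra.
have := support_Cauchy_Schwarz ht (cpositive_fusion_mul pa pb).
have := fusion_Young k0 hk pa pb a0 b0.
rewrite /support_size as_ aa hk; set N := tau (_ * _).
set r := tau (range_projection _).
have ta := trace_cpositive_gt0 pa a0; have tb := trace_cpositive_gt0 pb b0.
have r0 : 0 <= r.
  have [[rs rr] _ _] := range_projectionP ht (F (a * b)).
  have := trace_star_mul_ge0 ht (range_projection (F (a * b))).
  by rewrite rs rr.
move=> hN /le_trans/(_ (ler_wpM2l r0 hN)).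
(* The squared trace [(k * tau (F a) * tau (F b)) ^+ 2] is [tau (F a)] times this quantity, which
   therefore cancels. *)
have g0 : 0 < tau (F a) * (k * tau (F b)) ^+ 2.
  by rewrite mulr_gt0 // exprn_gt0 // mulr_gt0.
move=> h; rewrite -(ler_pM2r g0); apply: etrans h.
by congr (_ <= _); ring.
Qed.

End FusionBialgebraTheory.

Theorem theorem5p21 (R : realType) (A B : cstarType R) (F : 'Hom(A, B))
    (d : {scalar A}) (tau : {scalar B})
    (hfb : fusion_bialgebra F d tau) (hschur : dual_schur_property F)
    (x y : B) (hx : x <> 0) (hy : y <> 0) :
  Num.max (support_size tau x) (support_size tau y)
    <= support_size tau
         (dual_convolution F (range_projection x) (range_projection y)).
Proof.
have ht := fusion_tau_trace hfb; have FVK := fusion_FVK hfb.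
have prop z : z <> 0 -> exists a,
    [/\ F a = range_projection z, projection (F a) & F a <> 0].
  move=> z0; exists ((F^-1)%VF (range_projection z)); rewrite FVK.
  have [pr rz _] := range_projectionP ht z; split=> // r0.
  by apply: z0; rewrite -rz r0 mul0r.
(* [b] comes from [x] and [a] from [y], so that the reversing dual convolution becomes
   [F (a * b)]. *)
have [b [Fb pb b0]] := prop _ hx; have [a [Fa pa a0]] := prop _ hy.
rewrite -Fb -Fa; have cpa := cpositive_projection pa.
have cpb := cpositive_projection pb.
rewrite /dual_convolution (cpositive_star cpa) (cpositive_star cpb).
have cpab := cpositive_fusion_mul hfb hschur cpa cpb.
rewrite !(fusion_FK hfb) (cpositive_star cpab).
(* The maximum is one of the two supports: [tau (F a)] is bounded directly, [tau (F b)] after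
   commuting [a] and [b]. *)
rewrite maxEle; case: ifP => _.
  rewrite {1}/support_size -Fa.
  exact: (trace_le_support_fusion_mul hfb hschur).
rewrite (fusion_mulC hfb) {1}/support_size -Fb.
exact: (trace_le_support_fusion_mul hfb hschur).
Qed.
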